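(* An infinite cardinal $\kappa$ is a sequential cardinal if and only if the algebra $\mathcal P(\kappa)$ carries a nontrivial Maharam submeasure.
   Context: For a sequence $\langle b_n\rangle$ in a $\sigma$-complete Boolean algebra $B$, let $\overline{\lim}\, b_n=\bigwedge_k\bigvee_{n\ge k}b_n$ and $\underline{\lim}\, b_n=\bigvee_k\bigwedge_{n\ge k}b_n$; the sequence algebraically converges to $b$ if both equal $b$. The sequential topology $\tau_s$ on $B$ is the largest topology on $B$ in which every algebraically convergent sequence converges to its algebraic limit. An infinite cardinal $\kappa$ is a sequential cardinal if there exists a real-valued function on $\mathcal P(\kappa)$ which is continuous with respect to $\tau_s$ but not continuous with respect to the product topology (identifying $\mathcal P(\kappa)$ with $\{0,1\}^\kappa$). A submeasure on $\mathcal P(\kappa)$ is $\mu:\mathcal P(\kappa)\to[0,\infty)$ with $\mu(\emptyset)=0$, monotone and subadditive; it is a Maharam submeasure if $\lim_n\mu(a_n)=0$ for every decreasing sequence $\langle a_n\rangle$ with $\bigcap_n a_n=\emptyset$; it is nontrivial if $\mu(\kappa)>0$ and $\mu(\{\alpha\})=0$ for every $\alpha\in\kappa$. *)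

(* Defs.v *)
From HB Require Import structures.
From mathcomp Require Import all_boot all_order all_algebra.
From mathcomp Require Import all_classical all_reals all_analysis.
Import Order.TTheory GRing.Theory Num.Theory.
Import numFieldNormedType.Exports.

Set Implicit Arguments.
Unset Strict Implicit.
Unset Printing Implicit Defensive.

Local Open Scope classical_set_scope.
Local Open Scope ring_scope.

Definition set_limsup (T : Type) (b : nat -> set T) : set T :=
  \bigcap_k \bigcup_(n in [set n | (k <= n)%N]) b n.

Definition set_liminf (T : Type) (b : nat -> set T) : set T :=
  \bigcup_k \bigcap_(n in [set n | (k <= n)%N]) b n.

Definition alg_cvg (T : Type) (b : nat -> set T) (l : set T) : Prop :=
  set_limsup b = l /\ set_liminf b = l.

(* A topology on X presented as its collection of open sets; the empty set
   is the union of the empty subfamily. *)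
Definition is_topology (X : Type) (O : set (set X)) : Prop :=
  [/\ O setT,
      forall U V, O U -> O V -> O (U `&` V) &
      forall D : set (set X), D `<=` O -> O (\bigcup_(U in D) U)].

Definition topology_cvg (X : Type) (O : set (set X)) (b : nat -> X) (l : X) :
  Prop := forall U, O U -> U l -> \forall n \near \oo, U (b n).

Definition alg_cvg_topology (T : Type) (O : set (set (set T))) : Prop :=
  is_topology O /\ forall b l, alg_cvg b l -> topology_cvg O b l.

(* The union of all topologies in which algebraically convergent sequences
   converge; [seq_open_topology] and [seq_open_max] below show that it is
   itself such a topology, hence the largest one. *)
Definition seq_open (T : Type) : set (set (set T)) :=
  [set U | exists2 O, alg_cvg_topology O & O U].

Section SequentialTopology.
Variable T : Type.

Lemma seq_open_max (O : set (set (set T))) :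
  alg_cvg_topology O -> O `<=` @seq_open T.
Proof. by move=> tO U OU; exists O. Qed.

Lemma seq_open_topology : alg_cvg_topology (@seq_open T).
Proof.
pose S : set (set (set T)) := [set U | forall b l, alg_cvg b l -> U l ->
  \forall n \near \oo, U (b n)].
suff tS : alg_cvg_topology S.
  have -> // : @seq_open T = S.
  apply/seteqP; split; last exact: seq_open_max.
  by move=> U [tau [_ cvg_tau] tauU] b l bl Ul; exact: (cvg_tau b l bl U).
split; last by move=> b l bl U SU; exact: SU.
split.
- by move=> b l _ _; exact: nearW.
- by move=> U V SU SV b l bl [Ul Vl]; apply: filterI; [exact: SU bl Ul|exact: SV bl Vl].
- move=> D DS b l bl [U DU Ul].
  by apply: filterS (DS U DU b l bl Ul) => n Un; exists U.
Qed.

End SequentialTopology.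

(* The power set of T endowed with the sequential topology. *)
Definition seq_powerset (T : Type) : Type := set T.

HB.instance Definition _ (T : Type) := gen_eqMixin (seq_powerset T).
HB.instance Definition _ (T : Type) := gen_choiceMixin (seq_powerset T).

Section SeqPowersetTopology.
Variable T : Type.

Let openT : @seq_open T setT.
Proof. by have [[]] := seq_open_topology T. Qed.

Let openI : setI_closed (@seq_open T).
Proof. by have [[]] := seq_open_topology T. Qed.

Let open_bigU (I : Type) (f : I -> set (set T)) :
  (forall i, seq_open (f i)) -> seq_open (\bigcup_i f i).
Proof.
move=> fo; have [[_ _ bigU] _] := seq_open_topology T.
rewrite -(bigcup_image setT f id).
by apply: bigU => _ [i _ <-].
Qed.

HB.instance Definition _ :=
  isOpenTopological.Build (seq_powerset T) openT openI open_bigU.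

End SeqPowersetTopology.

Lemma seq_powerset_openE (T : Type) :
  (open : set (set (seq_powerset T))) = @seq_open T.
Proof.
have [[_ _ bigU] _] := seq_open_topology T.
apply/seteqP; split=> U; rewrite openE /=.
- move=> oU.
  have -> : U = \bigcup_(V in [set V | seq_open V /\ V `<=` U]) V.
    apply/seteqP; split=> [x /oU [V [Vo Vx VU]]|x [V [_ VU] /VU //]].
    by exists V.
  by apply: bigU => V [].
- by move=> oU x Ux; suff : nbhs_of_open (@seq_open T) x U by []; exists U; split.
Qed.

(* The second clause transports f along the identification of {0,1}^T with
   the power set of T, the product being that of discrete spaces. *)
Definition sequential_cardinal (R : realType) (T : Type) : Prop :=
  exists f : set T -> R,
    continuous (f : seq_powerset T -> R) /\
    ~ continuous (fun x : {ptws T -> bool} => f [set t | x t]).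

Definition submeasure (R : realType) (T : Type) (mu : set T -> R) : Prop :=
  [/\ forall A, 0 <= mu A,
      mu set0 = 0,
      forall A B, A `<=` B -> mu A <= mu B &
      forall A B, mu (A `|` B) <= mu A + mu B].

Definition maharam_submeasure (R : realType) (T : Type) (mu : set T -> R) :
  Prop :=
  submeasure mu /\
  forall a : nat -> set T, (forall n, a n.+1 `<=` a n) ->
    \bigcap_n a n = set0 -> mu (a n) @[n --> \oo] --> 0.

Definition nontrivial (R : realType) (T : Type) (mu : set T -> R) : Prop :=
  0 < mu setT /\ forall t, mu [set t] = 0.

(* Main.v *)
(** From a Maharam submeasure mu that vanishes on finite sets but not on the
    whole set one gets sequential continuity of mu itself; since finite sets
    are dense in the product topology, mu is not continuous there.

    Conversely, let g be sequentially continuous and discontinuous at c.  For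
    some e > 0 the hereditary family U of all x such that g moves by less than
    e from c along subsets of x contains no cofinite set, and U absorbs every
    decreasing sequence with empty intersection.  The point is to find an
    absorbing hereditary V with V \/ V inside U, and to iterate.  This is done
    within the class of "admissible" families, for which non-membership of x is
    witnessed by countably many values of g: removing from x a set that leaves
    these values unchanged keeps x outside.  If V did not exist, one could pick
    x_n, y_n with x_n `|` y_n outside U, both chosen so small with respect to
    everything chosen before that the witnesses for all the x_n `|` y_n are
    insensitive to the union s of limsup x_n and limsup y_n; but
    (x_n `|` y_n) \ s is dominated by a decreasing sequence with empty
    intersection, hence is eventually in U.  A sequence of families in
    which V_(n+1) \/ V_(n+1) is included in V_n then yields a Maharam
    submeasure by the Birkhoff-Kakutani construction, and taking the infimum
    over removals of finite sets makes it vanish on points. *)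
Require Import Defs.
From mathcomp Require Import all_boot all_order all_algebra.
From mathcomp Require Import all_classical all_reals all_analysis.
From mathcomp Require Import zify ring lra.
Import Order.TTheory GRing.Theory Num.Theory.
Import numFieldNormedType.Exports.

Set Implicit Arguments.
Unset Strict Implicit.
Unset Printing Implicit Defensive.

Local Open Scope classical_set_scope.
Local Open Scope ring_scope.

(** * Dependent choice with access to the whole history *)

Lemma history_choice (A : Type) (P : nat -> (nat -> A) -> A -> Prop) (a0 : A) :
  (forall n h h' a, (forall j, (j < n)%N -> h j = h' j) -> P n h a -> P n h' a) ->
  (forall n h, (forall j, (j < n)%N -> P j h (h j)) -> exists a, P n h a) ->
  exists h : nat -> A, forall n, P n h (h n).
Proof.
move=> Pext Pex.
(* Legality of the earlier choices sits under the arrow, which makes [F] total; strong induction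
   discharges it at the end. *)
have /choice[F HF] (nh : nat * (nat -> A)) : exists a,
    (forall j, (j < nh.1)%N -> P j nh.2 (nh.2 j)) -> P nh.1 nh.2 a.
  have [H|H] := pselect (forall j, (j < nh.1)%N -> P j nh.2 (nh.2 j)).
    by have [a Pa] := Pex _ _ H; exists a.
  by exists a0 => /H.
pose s := fix s n := if n is m.+1 then rcons (s m) (F (m, nth a0 (s m))) else [::].
have size_s n : size (s n) = n by elim: n => //= n IHn; rewrite size_rcons IHn.
pose h n := F (n, nth a0 (s n)).
have sh n j : (j < n)%N -> nth a0 (s n) j = h j.
  elim: n => // n IHn; rewrite ltnS leq_eqVlt /= nth_rcons size_s => /predU1P[->|jn].
    by rewrite ltnn eqxx.
  by rewrite jn IHn.
exists h; elim/ltn_ind => n IHn.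
apply: (Pext n (nth a0 (s n))); first exact: sh.
apply: (HF (n, _)) => /= j jn; rewrite sh//.
by apply: (Pext j h) (IHn _ jn) => i ij; rewrite sh// (ltn_trans ij jn).
Qed.

Ltac set_taut := let t := fresh "t" in
  apply/predeqP => t; rewrite /=;
  repeat (match goal with |- context [?A t] =>
    generalize (A t); let P := fresh "P" in intro P; destruct (EM P) end);
  tauto.

(** * Pointwise convergence, vanishing sequences, tails of sequences of sets *)

Section Sets.
Variable T : Type.
Implicit Types (w b : nat -> set T) (U V : set (set T)) (x y z c : set T).

Definition vanishing w :=
  (forall n, w n.+1 `<=` w n) /\ \bigcap_n w n = set0.

Lemma vanishing_le w m n : vanishing w -> (m <= n)%N -> w n `<=` w m.
Proof.
move=> [dw _]; elim: n => [|n IHn]; first by rewrite leqn0 => /eqP->.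
by rewrite leq_eqVlt => /predU1P[->//|/IHn]; apply: subset_trans.
Qed.

Lemma vanishing_near w t : vanishing w -> \forall n \near \oo, ~ w n t.
Proof.
move=> vw; have [n nwt] : exists n, ~ w n t.
  apply/existsNP => wt; suff : set0 t by [].
  by rewrite -vw.2 => n _; exact: wt.
near=> m => wmt; apply: nwt; apply: vanishing_le wmt => //.
by near: m; exact: nbhs_infty_ge.
Unshelve. all: by end_near. Qed.

Lemma vanishingU v w :
  vanishing v -> vanishing w -> vanishing (fun n => v n `|` w n).
Proof.
move=> vv vw; split=> [n|]; first by apply: setUSS; [exact: vv.1|exact: vw.1].
apply/seteqP; split=> // t vwt.
have [n [nvt nwt]] := filter_ex (filterI (vanishing_near t vv) (vanishing_near t vw)).
by case: (vwt n I).
Qed.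

(** Sequential convergence in the product topology; by [alg_cvgP] it coincides with algebraic
    convergence. *)
Definition ptw_cvg b (l : set T) :=
  forall t, \forall n \near \oo, b n t <-> l t.

Lemma ptw_cvg_bigcap w : (forall n, w n.+1 `<=` w n) -> ptw_cvg w (\bigcap_n w n).
Proof.
move=> dw t; have wW m n : (m <= n)%N -> w n `<=` w m.
  elim: n => [|n IHn]; first by rewrite leqn0 => /eqP->.
  by rewrite leq_eqVlt => /predU1P[->//|/IHn]; apply: subset_trans.
have [wt|/existsNP[n /not_implyP[_ nwt]]] := pselect ((\bigcap_n w n) t).
  by apply: nearW => n; split=> // _; exact: wt.
near=> m; split=> [wmt|]; last by apply.
by exfalso; apply: nwt; apply: wW wmt; near: m; exact: nbhs_infty_ge.
Unshelve. all: by end_near. Qed.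

Lemma ptw_cvg_bigcup w : (forall n, w n `<=` w n.+1) -> ptw_cvg w (\bigcup_n w n).
Proof.
move=> iw t; have := @ptw_cvg_bigcap (fun n => ~` w n) (fun n => subsetC (iw n)) t.
rewrite -setC_bigcup.
by apply: filterS => n /= [H1 H2]; split=> [wt|wt]; [exists n|apply: contrapT => /H1].
Qed.

Lemma alg_cvgP b (l : set T) :
  alg_cvg b l <-> ptw_cvg b l.
Proof.
split=> [[sl il] t|bl].
  have [lt|nlt] := pselect (l t).
    have [k _ bkt] : set_liminf b t by rewrite il.
    near=> n; split=> // _; apply: bkt => /=.
    by near: n; exact: nbhs_infty_ge.
  have /existsNP[k /not_implyP[_ bkt]] : ~ set_limsup b t by rewrite sl.
  near=> n; split=> // bnt; exfalso; apply: bkt; exists n => //.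
  by near: n; exact: nbhs_infty_ge.
have il : set_liminf b `<=` l.
  move=> t [k _ bkt]; have [n] := filter_ex (filterI (bl t) (nbhs_infty_ge k)).
  by move=> [[bnt _] kn]; apply/bnt/(bkt n kn).
have sl : l `<=` set_liminf b.
  by move=> t lt; have [k _ blt] := bl t; exists k => // n /blt [_]; apply.
split; last by apply/seteqP.
apply/seteqP; split=> [t bt|t /sl [k _ bkt] m _].
  by have [k _ blt] := bl t; have [n /blt [bl' _] /bl'] := bt k I.
by exists (maxn k m); [rewrite /= leq_maxr|exact: (bkt _ (leq_maxl k m))].
Unshelve. all: by end_near. Qed.

Lemma ptw_cvgYI b (l : set T) c z : ptw_cvg b l ->
  ptw_cvg (fun n => c `+` (z `&` b n)) (c `+` (z `&` l)).
Proof. by move=> bl t; apply: filterS (bl t) => n /=; tauto. Qed.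

Lemma ptw_cvgU b (l : set T) z : ptw_cvg b l ->
  ptw_cvg (fun n => b n `|` z) (l `|` z).
Proof. by move=> bl t; apply: filterS (bl t) => n /=; tauto. Qed.

(** The limit superior is reached by two monotone limits: segments increase to tails, and tails
    decrease to [set_limsup]. Estimates at finite segments are carried along both. *)
Definition segment b m n := \bigcup_(j in [set j | (m <= j < n)%N]) b j.

Definition tail b m := \bigcup_(j in [set j | (m <= j)%N]) b j.

Lemma segment_nil b m : segment b m m = set0.
Proof. by apply/seteqP; split=> // t [j /=]; lia. Qed.

Lemma segmentSr b m n : (m <= n)%N ->
  segment b m n.+1 = segment b m n `|` b n.
Proof.
move=> mn; apply/seteqP; split=> t.
  move=> [j /= /andP[mj]]; rewrite ltnS leq_eqVlt => /predU1P[->|jn]; first by right.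
  by move=> bj; left; exists j => //=; rewrite mj.
move=> [[j /= jmn bj]|bn]; first by exists j => //=; lia.
by exists n => //=; rewrite mn leqnn.
Qed.

Lemma eq_segment b b' m n : (forall j, (j < n)%N -> b j = b' j) ->
  segment b m n = segment b' m n.
Proof. by move=> bb'; apply: eq_bigcupr => j /= /andP[_ /bb']. Qed.

Lemma segment_ptw_cvg b m : ptw_cvg (segment b m) (tail b m).
Proof.
have -> : tail b m = \bigcup_n segment b m n.
  apply/seteqP; split=> [t [j /= mj bj]|t [n _ [j /= jmn bj]]].
    by exists j.+1 => //; exists j => //=; rewrite mj ltnSn.
  by exists j => //=; lia.
by apply: ptw_cvg_bigcup => n t [j /= jmn bj]; exists j => //=; lia.
Qed.

Lemma tailS b m : tail b m.+1 `<=` tail b m.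
Proof. by move=> t [j /= mj bj]; exists j => //=; exact: ltnW. Qed.

Lemma tail_ptw_cvg b : ptw_cvg (tail b) (set_limsup b).
Proof. by apply: ptw_cvg_bigcap => n; exact: tailS. Qed.

Lemma set_limsup_tail b m : set_limsup b `<=` tail b m.
Proof. by move=> t; apply. Qed.

Lemma sub_tail b m : b m `<=` tail b m.
Proof. by move=> t bt; exists m => /=. Qed.

Lemma vanishing_tailD b : vanishing (fun n => tail b n `\` set_limsup b).
Proof.
split=> [n t [bt nbt]|]; first by split=> //; exact: tailS.
apply/seteqP; split=> // t bt; have [_ nbt] := bt 0%N I.
by apply: nbt => n _; have [] := bt n I.
Qed.

End Sets.

(** * Sequentially continuous real functions on the power set *)

Section SequentialContinuity.
Variables (R : realType) (T : Type).
Implicit Types (w b : nat -> set T) (U V : set (set T)) (x y z c l s : set T).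

Definition seq_continuous (g : set T -> R) :=
  forall b l, ptw_cvg b l -> g (b n) @[n --> \oo] --> g l.

(** From right to left: the sequentially open sets [S] form a topology in which algebraic limits are
    limits, and preimages of open sets belong to it. *)
Lemma continuous_seqP (g : set T -> R) :
  continuous (g : seq_powerset T -> R) <-> seq_continuous g.
Proof.
have [tT cT] := seq_open_topology T; split.
  move=> gC b l /alg_cvgP bl A /= gA.
  have := gC l A gA; rewrite /= nbhsE /= => -[B [Bo Bl] BA].
  have : seq_open B by rewrite -seq_powerset_openE.
  by move=> /(cT b l bl) /(_ Bl); apply: filterS => n /BA.
move=> gC; apply/continuousP => A oA.
rewrite [X in X _]seq_powerset_openE.
pose S : set (set (set T)) := [set U | forall b l, alg_cvg b l -> U l ->
  \forall n \near \oo, U (b n)].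
exists S; last first.
  move=> b l /alg_cvgP bl Al; apply: (gC b l bl).
  exact: open_nbhs_nbhs.
split; last by move=> b l bl U SU; exact: SU.
split.
- by move=> b l _ _; exact: nearW.
- by move=> U V SU SV b l bl [Ul Vl]; apply: filterI; [exact: SU bl Ul|exact: SV bl Vl].
- move=> D DS b l bl [U DU Ul].
  by apply: filterS (DS U DU b l bl Ul) => n Un; exists U.
Qed.

Variable g : set T -> R.
Hypothesis gC : seq_continuous g.

Lemma seq_continuous_eq b b' l l' : ptw_cvg b l -> ptw_cvg b' l' ->
  (forall n, g (b n) = g (b' n)) -> g l = g l'.
Proof.
move=> /gC + /gC bl' bb'; have -> : (fun n => g (b n)) = (fun n => g (b' n)).
  exact/funext.
by move=> bl; apply: (cvg_unique _ bl bl').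
Qed.

Lemma seq_continuous_dist_le b l a e : ptw_cvg b l ->
  (\forall n \near \oo, `|g (b n) - a| <= e) -> `|g l - a| <= e.
Proof.
move=> /gC/cvgrPdist_lt bl be; apply/ler_addgt0Pl => d d0.
have [n [gn gna]] := filter_ex (filterI (bl _ d0) be).
by rewrite -(subrKA (g (b n))) (le_trans (ler_normD _ _))// lerD// ltW.
Qed.

(** Bad sets chosen inside each [w n] would converge pointwise to the empty set, against continuity
    at [c]. *)
Lemma seq_continuous_near0 c w e : vanishing w -> 0 < e ->
  exists n, forall z, z `<=` w n -> `|g (c `+` z) - g c| < e.
Proof.
move=> vw e0; apply: contrapT => /forallNP H.
have /choice[z Hz] n : exists z, z `<=` w n /\ e <= `|g (c `+` z) - g c|.
  have /existsNP[z /not_implyP[zw /negP]] := H n.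
  by rewrite -leNgt => ez; exists z.
have /gC/cvgrPdist_lt/(_ e e0) : ptw_cvg (fun n => c `+` z n) c.
  move=> t; apply: filterS (vanishing_near t vw) => n nwt.
  by have := (Hz n).1 t; rewrite /=; tauto.
move=> /filter_ex[n]; rewrite distrC ltNge => /negP; apply.
exact: (Hz n).2.
Qed.

End SequentialContinuity.

(** * Admissible families and their sequential interiors *)

Section AdmissibleFamilies.
Variables (R : realType) (T : Type) (g : set T -> R).
Hypothesis gC : seq_continuous g.
Implicit Types (w b : nat -> set T) (U V : set (set T)) (x y z c l s : set T).

(** Each pair is a test point with a mask. For the test point $c \triangle z$ with mask $z$, the
    condition says that deleting $s$ from $z$ is invisible to $g$. *)
Definition negligible_for (p : nat -> set T * set T) s :=
  forall i, g ((p i).1 `+` ((p i).2 `&` s)) = g (p i).1.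

Definition hereditary U := forall x y, x `<=` y -> U y -> U x.

Definition absorbing U := forall w, vanishing w -> exists n, U (w n).

(* Countability of the witness p is what lets diagonal arguments handle
   countably many non-members of U at once. *)
Definition stable U := forall x, ~ U x ->
  exists p, forall s, negligible_for p s -> ~ U (x `\` s).

Definition admissible U := [/\ hereditary U, absorbing U & stable U].

Definition oscillation_lt c (e : R) :=
  [set x | forall z, z `<=` x -> `|g (c `+` z) - g c| < e].

Lemma admissible_oscillation c e : 0 < e -> admissible (oscillation_lt c e).
Proof.
move=> e0; split.
- by move=> x y xy Uy z zx; apply: Uy; exact: subset_trans xy.
- by move=> w vw; have [n] := seq_continuous_near0 gC c vw e0; exists n.
- move=> x /existsNP[z /not_implyP[zx ez]].
  exists (fun=> (c `+` z, z)) => s /(_ 0%N) /= gs Us; apply: ez.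
  suff <- : g (c `+` (z `\` s)) = g (c `+` z) by apply: Us; exact: setSD.
  by rewrite -gs; congr g; set_taut.
Qed.

Lemma admissibleT : admissible setT.
Proof. by split=> // [w _|x []//]; exists 0%N. Qed.

Lemma admissibleI U V : admissible U -> admissible V -> admissible (U `&` V).
Proof.
move=> [hU aU sU] [hV aV sV]; split.
- by move=> x y xy [Uy Vy]; split; [apply: hU Uy|apply: hV Vy].
- move=> w vw; have [m Um] := aU w vw; have [n Vn] := aV w vw.
  by exists (maxn m n); split; [apply: hU Um|apply: hV Vn];
    apply: vanishing_le => //; rewrite ?leq_maxl ?leq_maxr.
- move=> x; have [Ux|nUx] := pselect (U x); last first.
    by move=> _; have [p Hp] := sU x nUx; exists p => s /Hp ns [].
  move=> nUVx; have [//|p Hp] := sV x _; first by move=> Vx; apply: nUVx.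
  by exists p => s /Hp ns [].
Qed.

Lemma admissible_forall n (U : nat -> set (set T)) :
  (forall i, (i < n)%N -> admissible (U i)) ->
  admissible [set x | forall i, (i < n)%N -> U i x].
Proof.
elim: n => [_|n IHn aU].
  by rewrite (_ : [set _ | _] = setT); [exact: admissibleT|exact/seteqP].
rewrite (_ : [set _ | _] = [set x | forall i, (i < n)%N -> U i x] `&` U n).
  by apply: admissibleI; [apply: IHn => i /ltnW/aU|exact: aU].
apply/seteqP; split=> x /= Ux; first by split=> [i /ltnW|]; exact: Ux.
by move=> i; rewrite ltnS leq_eqVlt => /predU1P[->|]; apply Ux.
Qed.

(* For admissible U a single step already yields an open family
   ([seq_interior_open]), although the sequential topology need not be
   Frechet-Urysohn. *)
Definition seq_interior U :=
  [set x | forall w, vanishing w -> exists n, U (x `|` w n)].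

Lemma seq_interior_sub U : hereditary U -> seq_interior U `<=` U.
Proof.
move=> hU x Ux; have [|n] := Ux (fun=> set0); last by rewrite setU0.
by split=> [n t|]; [|apply/seteqP; split=> // t /(_ 0%N I)].
Qed.

(* Weak distributivity as seen by g: f is built so that the strict bounds on
   g survive each step, and they pass to the limit superior. *)
Lemma negligible_diagonal (w : nat -> nat -> set T) p :
  (forall n, vanishing (w n)) ->
  exists f : nat -> nat, negligible_for p (set_limsup (fun n => w n (f n))).
Proof.
move=> vw.
pose S (h : nat -> nat) m n := segment (fun j => w j (h j)) m n.
(* Only test points of index at most m are constrained for segments starting at m, so each stage has
   finitely many conditions. *)
pose P n (h : nat -> nat) k := forall i m, (i <= m)%N -> (m <= n)%N ->
  `|g ((p i).1 `+` ((p i).2 `&` (S h m n `|` w n k))) - g (p i).1| < m.+1%:R^-1.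
have [||f Pf] := @history_choice _ P 0%N.
- move=> n h h' k hh' Ph i m im mn.
  rewrite /S (@eq_segment _ _ (fun j => w j (h j))); first exact: Ph.
  by move=> j jn; rewrite hh'.
- move=> n h Ph.
  have small i m : (i <= m)%N -> (m <= n)%N ->
      `|g ((p i).1 `+` ((p i).2 `&` S h m n)) - g (p i).1| < m.+1%:R^-1.
    move=> im; rewrite leq_eqVlt => /predU1P[->|mn].
      rewrite /S segment_nil setI0.
      by rewrite (_ : _ `+` set0 = (p i).1) ?subrr ?normr0//; exact: setY0.
    case: n mn Ph => // n mn Ph.
    by rewrite /S segmentSr//; exact: Ph.
  have /filter_ex[k Hk] : \forall k \near \oo, forall m i : 'I_n.+1, (i <= m)%N ->
      `|g ((p i).1 `+` ((p i).2 `&` (S h m n `|` w n k))) - g (p i).1| < m.+1%:R^-1.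
    apply: filter_forall => m; apply: filter_forall => i.
    have [im|] := boolP (i <= m)%N; last by move=> _; exact: nearW.
    have := small i m im (ltn_ord m); rewrite -subr_gt0 => gap.
    have wS : ptw_cvg (fun k => S h m n `|` w n k) (S h m n).
      move=> t; apply: filterS (vanishing_near t (vw n)) => k nwt.
      by split; [case|left].
    have /gC/cvgrPdist_lt/(_ _ gap) := ptw_cvgYI (p i).1 (p i).2 wS.
    apply: filterS => k; rewrite distrC => Hk _.
    rewrite -(subrKA (g ((p i).1 `+` ((p i).2 `&` S h m n)))).
    by rewrite (le_lt_trans (ler_normD _ _))// -ltrBrDr.
  exists k => i m im mn; have mn' : (m < n.+1)%N by [].
  by have := Hk (Ordinal mn') (Ordinal (leq_ltn_trans im mn')); exact.
exists f => i; apply/eqP; rewrite -subr_eq0 -normr_le0.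
have le_tail m : (i <= m)%N ->
    `|g ((p i).1 `+` ((p i).2 `&` tail (fun n => w n (f n)) m)) - g (p i).1|
    <= m.+1%:R^-1.
  move=> im; apply: (seq_continuous_dist_le gC).
    exact: ptw_cvgYI (segment_ptw_cvg _ _).
  apply: filterS (nbhs_infty_gt m) => -[//|n mn].
  by rewrite segmentSr//; apply/ltW/Pf.
apply/ler_addgt0Pl => e e0; rewrite addr0.
apply: (seq_continuous_dist_le gC).
  exact: ptw_cvgYI (tail_ptw_cvg _).
near=> m; apply: le_trans (le_tail m _) _; first by near: m; exact: nbhs_infty_ge.
apply: ltW; near: m; exact: near_infty_natSinv_lt (PosNum e0).
Unshelve. all: by end_near. Qed.

(** Otherwise vanishing sequences [v n] keep the sets outside [U]. Deleting the limit superior [s]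
    of a diagonal of the [v n] keeps them outside, yet makes the tails vanish, so that one of them
    is in [U] after all. *)
Lemma seq_interior_open U x w : admissible U -> seq_interior U x ->
  vanishing w -> exists n, seq_interior U (x `|` w n).
Proof.
move=> [hU aU sU] Ux vw; apply: contrapT => /forallNP nU.
have /choice[v Hv] n : exists v, vanishing v /\ forall k, ~ U (x `|` w n `|` v k).
  have /existsNP[v /not_implyP[vv /forallNP nUv]] := nU n.
  by exists v.
have vv n := (Hv n).1.
have /choice[q Hq] (nk : nat * nat) : exists p, forall s, negligible_for p s ->
    ~ U ((x `|` w nk.1 `|` v nk.1 nk.2) `\` s).
  by apply: sU; exact: (Hv nk.1).2.
(* Countably many witnesses are merged into one; a code that decodes to nothing gets the empty mask,
   which constrains nothing. *)
pose p i := if @unpickle (nat * nat * nat)%type i is Some (nk, j) then q nk j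
            else (set0, set0).
have [f] := negligible_diagonal p vv.
set s := set_limsup _ => ps.
have [] := Ux (fun n => w n `|` (tail (fun n => v n (f n)) n `\` s)).
  exact: (vanishingU vw (vanishing_tailD _)).
move=> n Un; apply: (Hq (n, f n) s).
  by move=> j; have := ps (pickle ((n, f n), j)); rewrite /p pickleK.
apply: hU Un => t [[[xt|wt]|vt] nst]; [by left|by right; left|right; right].
by split=> //; exact: (@sub_tail _ (fun n => v n (f n))).
Qed.

Lemma admissible_seq_interior U : admissible U -> admissible (seq_interior U).
Proof.
move=> aU; have [hU abU sU] := aU; split.
- move=> x y xy Uy w vw; have [n Un] := Uy w vw; exists n.
  by apply: hU Un; exact: setSU.
- have U0 : seq_interior U set0.
    by move=> w vw; have [n] := abU w vw; exists n; rewrite set0U.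
  move=> w vw; have [n] := seq_interior_open aU U0 vw.
  by rewrite set0U; exists n.
- move=> x /existsNP[w /not_implyP[vw /forallNP nU]].
  have /choice[q Hq] n := sU _ (nU n).
  pose p i := if @unpickle (nat * nat)%type i is Some (n, j) then q n j
              else (set0, set0).
  exists p => s ps /(_ w vw)[n Un]; apply: (Hq n s).
    by move=> j; have := ps (pickle (n, j)); rewrite /p pickleK.
  by apply: hU Un => t [[xt|wt] nst]; [left|right].
Qed.

(** Used with [c] the union of the moves already made: the next move can be sought in an admissible
    family. *)
Lemma admissible_shift U c : admissible U -> seq_interior U c ->
  admissible [set v | seq_interior U (c `|` v)].
Proof.
move=> aU Uc; have [hI _ sI] := admissible_seq_interior aU; split.
- by move=> x y xy; apply: hI; exact: setUS.
- by move=> w vw; exact: seq_interior_open.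
- move=> x /sI[p Hp]; exists p => s /Hp nU Us; apply: nU.
  by apply: hI Us => t [[ct|xt] nst]; [left|right].
Qed.

End AdmissibleFamilies.

(** * Halving an admissible family *)

Section Halving.
Variables (R : realType) (T : Type) (g : set T -> R).
Hypothesis gC : seq_continuous g.
Implicit Types (U V : set (set T)) (x y z c l s : set T).

(* A round of the construction: the sets x_n, y_n and a witness for
   x_n `|` y_n lying outside U. *)
Definition round := (set T * set T * (nat -> set T * set T))%type.
Implicit Type h : nat -> round.

Definition fst_move h j := (h j).1.1.
Definition snd_move h j := (h j).1.2.

(** Insensitivity at test points already altered by first moves is what lets the limit superior of
    the second moves be removed together with that of the first. *)
Definition base_point h j i a b :=
  ((h j).2 i).1 `+` (((h j).2 i).2 `&` segment (fst_move h) a b).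

(* Finitely many constraints at stage m; every base point is eventually
   among them. *)
Definition target h m := [set z | forall j, (j < m)%N -> forall i, (i < m)%N ->
  forall a, (a < m)%N -> forall b, (b < m)%N ->
  oscillation_lt g (base_point h j i a b) m.+1%:R^-1 z].

Lemma admissible_target h m : admissible g (target h m).
Proof.
do 4!(apply: admissible_forall => ? _).
by apply: admissible_oscillation => //; rewrite invr_gt0.
Qed.

(** Asking for the interior of each target, not just the target, leaves room for later moves. *)
Definition legal_round U n h (r : round) :=
  [/\ forall m, (m <= n)%N ->
        seq_interior (target h m) (segment (fst_move h) m n `|` r.1.1) /\
        seq_interior (target h m) (segment (snd_move h) m n `|` r.1.2),
      ~ U (r.1.1 `|` r.1.2) &
      forall s, negligible_for g r.2 s -> ~ U ((r.1.1 `|` r.1.2) `\` s)].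

Lemma eq_target h h' m : (forall j, (j < m)%N -> h j = h' j) ->
  target h m `<=` target h' m.
Proof.
move=> hh' z tz j jm i im a am b bm; have := tz j jm i im a am b bm.
rewrite /base_point hh'// (@eq_segment _ (fst_move h) (fst_move h'))// => k kb.
by rewrite /fst_move hh'// (ltn_trans kb).
Qed.

Lemma eq_legal_round U n h h' r : (forall j, (j < n)%N -> h j = h' j) ->
  legal_round U n h r -> legal_round U n h' r.
Proof.
move=> hh' [lr nU pU]; split=> // m mn.
have hh'm j : (j < m)%N -> h j = h' j by move=> jm; rewrite hh'// (leq_trans jm).
have tt' w : seq_interior (target h m) w -> seq_interior (target h' m) w.
  move=> tw v vv; have [k] := tw v vv; exists k; exact: (eq_target hh'm).
have [] := lr m mn.
rewrite (@eq_segment _ (fst_move h) (fst_move h')); last first.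
  by move=> j jn; rewrite /fst_move hh'.
rewrite (@eq_segment _ (snd_move h) (snd_move h')); last first.
  by move=> j jn; rewrite /snd_move hh'.
by move=> /tt' ? /tt' ?.
Qed.

Lemma admissible_halving U : admissible g U ->
  exists2 V, admissible g V & forall x y, V x -> V y -> U (x `|` y).
Proof.
move=> aU; have [hU abU sU] := aU.
apply: contrapT => /forall2NP H.
have [||h Ph] := @history_choice round (legal_round U) (set0, set0, fun=> (set0, set0)).
- by move=> n h h' r; exact: eq_legal_round.
- move=> n h Ph.
  have int_seg m : (m <= n)%N ->
      seq_interior (target h m) (segment (fst_move h) m n) /\
      seq_interior (target h m) (segment (snd_move h) m n).
    rewrite leq_eqVlt => /predU1P[->|mn].
      have [_ t0 _] := admissible_target h n.
      by rewrite !segment_nil; split=> w vw; have [k] := t0 w vw; exists k; rewrite set0U.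
    case: n mn Ph => // n mn Ph; rewrite !segmentSr//.
    by have [+ _ _] := Ph n (ltnSn n); exact.
  (* By assumption this admissible family contains two sets whose union is outside [U]; they are the
     next moves. *)
  pose V := [set v | forall m, (m < n.+1)%N ->
    ([set v | seq_interior (target h m) (segment (fst_move h) m n `|` v)] `&`
     [set v | seq_interior (target h m) (segment (snd_move h) m n `|` v)]) v].
  have aV : admissible g V.
    apply: admissible_forall => m /int_seg[iX iY].
    by apply: admissibleI; apply: admissible_shift => //; exact: admissible_target.
  have [//|] := H V.
  move=> /existsNP[x /existsNP[y /not_implyP[Vx /not_implyP[Vy nU]]]].
  have [p Hp] := sU _ nU.
  by exists (x, y, p); split=> // m mn; split; [exact: (Vx m mn).1|exact: (Vy m mn).2].
pose sx := set_limsup (fst_move h); pose sy := set_limsup (snd_move h).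
have int_seg m n : (m < n)%N ->
    target h m (segment (fst_move h) m n) /\ target h m (segment (snd_move h) m n).
  case: n => // n mn; have [/(_ m mn)[iX iY] _ _] := Ph n.
  have [hT _ _] := admissible_target h m.
  by rewrite !segmentSr//; split; exact: seq_interior_sub.
(* For all large m, a subset of [sx] or [sy] is a limit of subsets of segments belonging to
   [target h m], so it moves [g] by at most 1/(m+1). *)
have base_null j i a b z : z `<=` sx \/ z `<=` sy ->
    g (base_point h j i a b `+` z) = g (base_point h j i a b).
  move=> zs; apply/eqP; rewrite -subr_eq0 -normr_le0.
  apply/ler_addgt0Pl => e e0; rewrite addr0.
  have close m : (j < m)%N -> (i < m)%N -> (a < m)%N -> (b < m)%N ->
      `|g (base_point h j i a b `+` z) - g (base_point h j i a b)| <= m.+1%:R^-1.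
    move=> jm im am bm.
    have close_tail u : (forall n, (m < n)%N -> target h m (segment u m n)) ->
        z `<=` set_limsup u ->
        `|g (base_point h j i a b `+` z) - g (base_point h j i a b)| <= m.+1%:R^-1.
      move=> tu zu.
      have -> : z = z `&` tail u m.
        by apply/esym/setIidl/(subset_trans zu); exact: set_limsup_tail.
      apply: (seq_continuous_dist_le gC).
        exact: ptw_cvgYI (segment_ptw_cvg _ _).
      apply: filterS (nbhs_infty_gt m) => n mn.
      by apply/ltW/(tu n mn j jm i im a am b bm) => t [].
    by case: zs => /close_tail; apply=> n mn; have [] := int_seg m n mn.
  near \oo => m.
  apply: (@le_trans _ _ m.+1%:R^-1).
    by apply: close; near: m; exact: nbhs_infty_gt.
  by apply: ltW; near: m; exact: near_infty_natSinv_lt (PosNum e0).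
(* Without [sx] and [sy] the tails vanish and [U] absorbs them, against round [n] once the union of
   [sx] and [sy] is negligible. *)
have [n Un] := abU _ (vanishingU (vanishing_tailD (fst_move h))
                                 (vanishing_tailD (snd_move h))).
have [_ _ /(_ (sx `|` sy))] := Ph n; apply; last first.
  apply: hU Un => t [[xt|yt] nst]; [left|right]; split=> //.
  - exact: (@sub_tail _ (fst_move h)).
  - by move=> sxt; apply: nst; left.
  - exact: (@sub_tail _ (snd_move h)).
  - by move=> sxt; apply: nst; right.
move=> i; set c := ((h n).2 i).1; set z := ((h n).2 i).2.
have bpE a b : base_point h n i a b = c `+` (z `&` segment (fst_move h) a b) by [].
(* First [sy] is dropped at points altered by a segment of first moves. Letting the end and then the
   start of the segment tend to infinity turns it into [sx], which is dropped last, at the unaltered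
   point. *)
have Xab a b : g (c `+` (z `&` (segment (fst_move h) a b `|` sy))) =
               g (c `+` (z `&` segment (fst_move h) a b)).
  rewrite -bpE -(base_null n i a b ((z `&` sy) `\` segment (fst_move h) a b)).
    by rewrite bpE; congr g; move: (segment _ _ _) (sy) => S S'; set_taut.
  by right => t [[]].
have Xa a : g (c `+` (z `&` (tail (fst_move h) a `|` sy))) =
            g (c `+` (z `&` tail (fst_move h) a)).
  apply: (seq_continuous_eq gC _ _ (Xab a)); apply: ptw_cvgYI;
    [apply: ptw_cvgU|]; exact: segment_ptw_cvg.
have -> : g (c `+` (z `&` (sx `|` sy))) = g (c `+` (z `&` sx)).
  apply: (seq_continuous_eq gC _ _ Xa); apply: ptw_cvgYI;
    [apply: ptw_cvgU|]; exact: tail_ptw_cvg.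
have := base_null n i 0%N 0%N (z `&` sx); rewrite bpE segment_nil setI0.
rewrite (_ : c `+` set0 = c); last exact: setY0.
by apply; left => t [].
Unshelve. all: by end_near. Qed.

End Halving.

(** * The Birkhoff-Kakutani construction of a submeasure *)

Section Metrization.
Variables (R : realType) (T : Type) (V : nat -> set (set T)).
Hypothesis hV : forall n, hereditary (V n).
Hypothesis aV : forall n, absorbing (V n).
Hypothesis VU : forall n x y, V n.+1 x -> V n.+1 y -> V n (x `|` y).
Implicit Types (x y z : set T).

(* Sets of "size at most m / 2^K", where a member of [V k] has size 2^-k: the
   binary digits of m select the families whose members are joined. *)
Fixpoint dyadic (K m : nat) : set (set T) :=
  if K is K'.+1 then
    if odd m then
      [set x | exists y z, [/\ dyadic K' m./2 y, V K z & x `<=` y `|` z]]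
    else dyadic K' m./2
  else if m is 0%N then [set set0] else setT.

Let Vset0 n : V n set0.
Proof.
have [|k //] := aV n (w := fun=> set0).
by split=> [? ?|]; [|apply/seteqP; split=> // t /(_ 0%N I)].
Qed.

Lemma dyadic_hereditary K m : hereditary (dyadic K m).
Proof.
elim: K m => [|K IHK] m x y xy /=.
  by case: m => //= y0; apply/seteqP; split=> //; rewrite -y0.
case: ifP => _; last exact: (IHK _ _ _ xy).
by move=> [u [v [du Vv yuv]]]; exists u, v; split=> //; exact: subset_trans yuv.
Qed.

Lemma dyadic_set0 K m : dyadic K m set0.
Proof.
elim: K m => [[|m]|K IHK m] //=.
by case: ifP => _ //; exists set0, set0; split.
Qed.

Lemma dyadic_double K m : dyadic K.+1 m.*2 = dyadic K m.
Proof. by rewrite /= odd_double doubleK. Qed.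

Lemma dyadic_mul2X j K m : dyadic (j + K) (2 ^ j * m) = dyadic K m.
Proof.
elim: j => [|j IHj]; first by rewrite mul1n.
by rewrite addSn expnS -mulnA mul2n dyadic_double.
Qed.

Lemma sub_dyadic1 k : V k `<=` dyadic k 1.
Proof.
case: k => [|k] x Vx //=; exists set0, x; split=> //; exact: dyadic_set0.
Qed.

(** Binary addition: when both last digits are 1, the two members of [V K.+1] join to a member of
    [V K], which is the carry. *)
Lemma dyadicU K m n x y :
  dyadic K m x -> dyadic K n y -> dyadic K (m + n) (x `|` y).
Proof.
elim: K m n x y => [|K IHK] m n x y.
  by case: m n => [|m] [|n] //= -> ->; rewrite setU0.
rewrite /= oddD halfD; case: (odd m) (odd n) => -[] /=; rewrite ?add0n.
- move=> [u [v [du Vv xuv]]] [u' [v' [du' Vv' yuv']]].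
  have d1 : dyadic K 1 (v `|` v') by apply/sub_dyadic1/VU.
  apply: dyadic_hereditary (IHK _ _ _ _ d1 (IHK _ _ _ _ du du')).
  by move=> t [/xuv[]|/yuv'[]] ?; [right; left|left; left|right; right|left; right].
- move=> [u [v [du Vv xuv]]] dy; exists (u `|` y), v.
  split=> //; first exact: IHK.
  by move=> t [/xuv[]|] ?; [left; left|right|left; right].
- move=> dx [u [v [du Vv yuv]]]; exists (x `|` u), v.
  split=> //; first exact: IHK.
  by move=> t [|/yuv[]] ?; [left; left|left; right|right].
- exact: IHK.
Qed.

Lemma dyadic_le K m n : (m <= n)%N -> dyadic K m `<=` dyadic K n.
Proof.
move=> /subnK <- x dx; rewrite -(set0U x); apply: dyadicU => //.
exact: dyadic_set0.
Qed.

(** Raising the numerator to exactly half the denominator and cancelling powers of two leaves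
    [dyadic 1 1], whose members lie in [V 1]. *)
Lemma dyadic_lt_half K m x : (m.*2 <= 2 ^ K)%N -> dyadic K m x -> V 1 x.
Proof.
case: K => [|K].
  by rewrite expn0; case: m => [|m] //= _ ->.
rewrite expnS mul2n leq_double => mK /(dyadic_le mK).
rewrite -(muln1 (2 ^ K)%N) -addn1 dyadic_mul2X /= => -[y [z [-> Vz]]].
by rewrite set0U => /hV; exact.
Qed.

Definition dyadic_values x : set R :=
  [set r | exists K m, dyadic K m x /\ r = m%:R / 2 ^+ K].

Definition dyadic_submeasure x : R := inf (dyadic_values x).

Let values_ge0 x : lbound (dyadic_values x) 0.
Proof. by move=> _ [K [m [_ ->]]]; rewrite divr_ge0// exprn_ge0. Qed.

Let values_neq0 x : dyadic_values x !=set0.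
Proof. by exists 1, 0%N, 1%N; rewrite expr0 divr1. Qed.

Lemma dyadic_submeasure_le K m x :
  dyadic K m x -> dyadic_submeasure x <= m%:R / 2 ^+ K.
Proof. by move=> dx; apply: ge_inf; [exists 0|exists K, m]. Qed.

Lemma dyadic_submeasure_lt x r : dyadic_submeasure x < r ->
  exists K m, dyadic K m x /\ m%:R / 2 ^+ K < r.
Proof.
move=> xr; have [] := @inf_adherent _ (dyadic_values x) (r - dyadic_submeasure x).
- by rewrite subr_gt0.
- by split; [exact: values_neq0|exists 0].
- by move=> _ [K [m [dx ->]]]; rewrite addrC subrK => ?; exists K, m.
Qed.

Lemma submeasure_dyadic : submeasure dyadic_submeasure.
Proof.
split.
- by move=> x; apply: lb_le_inf.
- apply/eqP; rewrite eq_le lb_le_inf// andbT.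
  by apply: le_trans (@dyadic_submeasure_le 0%N 0%N _ _) _; rewrite ?mul0r.
- move=> x y xy; apply: lb_le_inf => // _ [K [m [dy ->]]].
  exact/dyadic_submeasure_le/(dyadic_hereditary xy).
- move=> x y; apply/ler_addgt0Pl => e e0; have e20 : 0 < e / 2 by rewrite divr_gt0.
  have [K [m [dx xr]]] : exists K m, dyadic K m x /\
      m%:R / 2 ^+ K < dyadic_submeasure x + e / 2.
    by apply: dyadic_submeasure_lt; rewrite ltrDl.
  have [L [n [dy yr]]] : exists K m, dyadic K m y /\
      m%:R / 2 ^+ K < dyadic_submeasure y + e / 2.
    by apply: dyadic_submeasure_lt; rewrite ltrDl.
  rewrite -(dyadic_mul2X L) in dx; rewrite -(dyadic_mul2X K) addnC in dy.
  apply: le_trans (dyadic_submeasure_le (dyadicU dx dy)) _.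
  rewrite natrD !natrM !natrX exprD.
  have two k : (2 : R) ^+ k != 0 by rewrite expf_neq0.
  have := two K; have := two L; move: ((2 : R) ^+ K) ((2 : R) ^+ L) xr yr => p q xr yr p0 q0.
  have -> : (q * m%:R + p * n%:R) / (q * p) = m%:R / p + n%:R / q.
    by field; rewrite p0 q0.
  lra.
Qed.

Lemma exists_maharam_submeasure : exists mu : set T -> R,
  maharam_submeasure mu /\ forall x, mu x < 2^-1 -> V 1 x.
Proof.
exists dyadic_submeasure; split; last first.
  move=> x /dyadic_submeasure_lt[K [m [dx]]].
  rewrite ltr_pdivrMr ?exprn_gt0// ltr_pdivlMl// -natrX -natrM ltr_nat => mK.
  by apply: dyadic_lt_half dx; rewrite -mul2n ltnW.
have [mu0 muE mule muU] := submeasure_dyadic.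
split=> // a da ia; have va : vanishing a by [].
apply/cvgrPdist_le => e e0.
(* Absorption puts some [a n] in [V k], so the submeasure is at most 2^-k from [n] on. *)
near \oo => k; have [n Vn] := aV k va.
near=> m; rewrite sub0r normrN ger0_norm//.
apply: le_trans (mule _ _ (_ : a m `<=` a n)) _.
  by apply: vanishing_le => //; near: m; exact: nbhs_infty_ge.
apply: le_trans (dyadic_submeasure_le (sub_dyadic1 Vn)) _.
apply: ltW.
by near: k; exact: (near_infty_natSinv_expn_lt (PosNum e0)).
Unshelve. all: by end_near. Qed.

End Metrization.

(** * Finite sets and the product topology *)

Lemma finite_set_ind (T : Type) (P : set T -> Prop) :
  P set0 -> (forall t A, P A -> P (t |` A)) -> forall A, finite_set A -> P A.
Proof.
move=> P0 PU A; have key (s : seq {classic T}) : P [set` s].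
  elim: s => [|t s IHs]; first by rewrite set_nil.
  rewrite (_ : [set` _] = t |` [set` s]); first exact: PU.
  apply/seteqP; split=> u /=; rewrite inE.
    by case/predU1P => [->|]; [left|right].
  by case=> [->|us]; rewrite ?eqxx// us orbT.
by move=> /(@finite_seqP {classic T})[s ->].
Qed.

Section Cylinders.
Variable T : Type.

Lemma nbhs_cylinder (x : {ptws T -> bool}) (F : set T) : finite_set F ->
  \forall y \near x, forall t, F t -> y t = x t.
Proof.
have FF : Filter (nbhs x) := nbhs_filter x.
move=> fF; elim/finite_set_ind: F / fF => [|t F IHF].
  by apply: (@nearW _ _ _ FF) => y t [].
have xt : \forall y \near x, y t = x t.
  have /cvg_sup/(_ t) : nbhs x --> x by exact: cvg_id.
  by apply; exact: initial_continuous (discrete_set1 (x t)).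
by apply: (filterS2 FF _ xt IHF) => y yt yF s [->|/yF].
Qed.

(** The restrictions of [x] to finite sets, directed by inclusion, form a net converging to [x]; [G]
    is its filter. *)
Lemma finite_dense (x : {ptws T -> bool}) A : nbhs x A ->
  exists y, A y /\ finite_set [set t | y t].
Proof.
pose G : set_system {ptws T -> bool} := [set B | exists2 F, finite_set F &
  forall F', finite_set F' -> F `<=` F' -> B (fun t => x t && `[< F' t >])].
have GF : Filter G.
  split.
  - by exists set0.
  - move=> B C [F fF FB] [F' fF' FC]; exists (F `|` F').
      by rewrite finite_setU.
    by move=> H fH FH; split; [apply: FB|apply: FC] => // t Ft; apply: FH; [left|right].
  - by move=> B C BC [F fF FB]; exists F => // F' fF' FF'; exact/BC/FB.
have Gx : G --> x.
  have evalT t : (fun y : T -> bool => y t) @` setT = setT.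
    by apply/seteqP; split=> // b _; exists (fun=> b).
  apply/cvg_sup => t; apply/(cvg_image _ _ (evalT t)) => B Bx.
  exists ((fun y : T -> bool => y t) @^-1` B); last exact: image_preimage.
  exists [set t]; first exact: finite_set1.
  move=> F' _ tF' /=; rewrite (asboolT (tF' t erefl)) andbT.
  exact: nbhs_singleton Bx.
move=> /Gx[F fF FA]; exists (fun t => x t && `[< F t >]); split; first exact: FA.
by apply: sub_finite_set fF => t /= /andP[_ /asboolP].
Qed.

End Cylinders.

(** * Continuity of Maharam submeasures and the passage to a nontrivial one *)

Section Nontrivial.
Variables (R : realType) (T : Type).
Implicit Types (mu : set T -> R).

Lemma nontrivial_finite mu (F : set T) :
  submeasure mu -> nontrivial mu -> finite_set F -> mu F = 0.
Proof.
move=> [mu0 muE _ muU] [_ mu1] fF; elim/finite_set_ind: F / fF => // t F IHF.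
by apply/eqP; rewrite eq_le mu0 andbT (le_trans (muU _ _))// mu1 IHF addr0.
Qed.

(** The increment of [mu] is bounded by its value on the symmetric difference of [b n] and [l],
    which lies in a tail decreasing to the empty set. *)
Lemma maharam_seq_continuous mu : maharam_submeasure mu -> seq_continuous mu.
Proof.
move=> [[mu0 muE mule muU] mu_van] b l bl.
pose v := tail (fun n => b n `+` l).
have lim0 : set_limsup (fun n => b n `+` l) = set0.
  apply/seteqP; split=> // t vt; have [n _ nbl] := bl t.
  have [m /= nm] := vt n I; have := nbl m nm; tauto.
have /cvgrPdist_lt v0 : mu (v n) @[n --> \oo] --> 0.
  apply: mu_van => [n|]; [exact: tailS|exact: lim0].
apply/cvgrPdist_lt => e /v0; apply: filterS => n.
rewrite sub0r normrN ger0_norm// => vn; apply: le_lt_trans vn.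
have sub x y z : x `<=` y `|` z -> mu x <= mu y + mu z.
  by move=> /mule xyz; exact: le_trans xyz (muU _ _).
rewrite ler_norml; apply/andP; split.
  rewrite lerBrDl lerBlDr; apply: sub => t bt.
  by have [lt|lt] := pselect (l t); [left|right; apply: sub_tail; left].
rewrite lerBlDr addrC; apply: sub => t lt.
by have [bt|bt] := pselect (b n t); [left|right; apply: sub_tail; right].
Qed.

(** Subadditivity survives the infimum because finite sets are closed under union, and continuity
    survives because [nu] is at most [mu]. *)
Lemma nontrivial_quotient mu (d : R) : maharam_submeasure mu -> 0 < d ->
  (forall F, finite_set F -> d <= mu (~` F)) ->
  exists nu : set T -> R, maharam_submeasure nu /\ nontrivial nu.
Proof.
move=> [[mu0 muE mule muU] mu_van] d0 dF.
pose S x := [set mu (x `\` F) | F in [set F : set T | finite_set F]].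
have S0 x : lbound (S x) 0 by move=> _ [F _ <-].
have Sne x : S x !=set0 by exists (mu (x `\` set0)), set0 => //=; exact: finite_set0.
pose nu x := inf (S x).
have nu_le x F : finite_set F -> nu x <= mu (x `\` F).
  by move=> fF; apply: ge_inf; [exists 0|exists F].
have nu_mu x : nu x <= mu x by rewrite -[x in mu x]setD0 nu_le//; exact: finite_set0.
have nu0 x : 0 <= nu x by exact: lb_le_inf.
exists nu; split; last first.
  split=> [|t].
    apply: lt_le_trans d0 _; apply: lb_le_inf => // _ [F fF <-].
    by rewrite setTD; exact: dF.
  by apply/eqP; rewrite eq_le nu0 andbT -muE -(setDv [set t]) nu_le.
split.
  split=> //.
  - by apply/eqP; rewrite eq_le nu0 andbT -muE.
  - move=> A B AB; apply: lb_le_inf => // _ [F fF <-].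
    by apply: le_trans (nu_le A F fF) _; apply: mule; exact: setSD.
  - move=> A B; apply/ler_addgt0Pl => e e0; have e20 : 0 < e / 2 by rewrite divr_gt0.
    have [//|_ [F fF <-] AF] := @inf_adherent _ (S A) _ e20; first by split; [|exists 0].
    have [//|_ [H fH <-] BH] := @inf_adherent _ (S B) _ e20; first by split; [|exists 0].
    have fFH : finite_set (F `|` H) by rewrite finite_setU.
    apply: le_trans (nu_le _ _ fFH) _.
    have ABFH : mu ((A `|` B) `\` (F `|` H)) <= mu (A `\` F) + mu (B `\` H).
      apply: le_trans (muU _ _); apply: mule => t [[At|Bt] nFH]; [left|right];
        split=> // ?; apply: nFH; by [left|right].
    rewrite -/(nu A) in AF; rewrite -/(nu B) in BH; lra.
move=> a da ia; apply: (@squeeze_cvgr _ _ _ _ (fun=> 0) (fun n => mu (a n))).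
- by apply: nearW => n; rewrite nu0 nu_mu.
- exact: cvg_cst.
- exact: mu_van.
Qed.

End Nontrivial.

(** * Oscillation, discontinuity and the equivalence *)

Lemma oscillation_maharam (R : realType) (T : Type) (g : set T -> R) (c : set T)
    (e : R) : seq_continuous g -> 0 < e ->
  exists mu : set T -> R, maharam_submeasure mu /\
    forall x, mu x < 2^-1 -> oscillation_lt g c e x.
Proof.
move=> gC e0.
have /choice[half half_half] (U : set (set T)) : exists V, admissible g U ->
    admissible g V /\ forall x y, V x -> V y -> U (x `|` y).
  have [aU|] := pselect (admissible g U); last by exists U.
  by have [V aV VU] := admissible_halving gC aU; exists V.
(* The sequence starts with the whole power set so that [V 1], the family controlled by values below
   1/2, is the oscillation family. *)
pose V n := if n is m.+1 then iter m half (oscillation_lt g c e) else setT.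
have aV n : admissible g (V n.+1).
  elim: n => [|n IHn]; first exact: admissible_oscillation.
  by have [] := half_half _ IHn.
apply: (@exists_maharam_submeasure R T V) => //.
- by move=> [|n]; [|have [] := aV n].
- by move=> [|n]; [move=> ? _; exists 0%N|have [] := aV n].
- by move=> [|n] // x y; have [_] := half_half _ (aV n); exact.
Qed.

(** Points that agree on a finite [F] differ by a subset of its complement, so small oscillation
    there would make [f] continuous. *)
Lemma not_continuous_oscillation (R : realType) (T : Type) (f : set T -> R) :
  ~ continuous (fun x : {ptws T -> bool} => f [set t | x t]) ->
  exists c e, 0 < e /\ forall F, finite_set F -> ~ oscillation_lt f c e (~` F).
Proof.
move=> nC; apply: contrapT => H; apply: nC => x; apply/cvgrPdist_lt => e e0.
have [F fF oF] : exists2 F, finite_set F & oscillation_lt f [set t | x t] e (~` F).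
  apply: contrapT => nF; apply: H; exists [set t | x t], e; split=> // F fF oF.
  by apply: nF; exists F.
apply: filterS (nbhs_cylinder x fF) => y yx; rewrite distrC.
have := oF ([set t | x t] `+` [set t | y t]).
rewrite (_ : _ `+` (_ `+` _) = [set t | y t]); last first.
  by move: [set t | x t] [set t | y t] => A B; set_taut.
by apply => t /= xyt Ft; move: xyt; rewrite yx//; tauto.
Qed.

Theorem theorem6p2 (R : realType) (kappa : Type)
    (kappa_infinite : infinite_set [set: kappa]%classic) :
  sequential_cardinal R kappa <->
  exists mu : set kappa -> R, maharam_submeasure mu /\ nontrivial mu.
Proof.
split=> [[f [/continuous_seqP fC /not_continuous_oscillation[c [e [e0 nosc]]]]]|].
  have [mu [mmu muosc]] := oscillation_maharam c fC e0.
  apply: (nontrivial_quotient mmu (d := 2^-1)) => // F fF.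
  by rewrite leNgt; apply/negP => /muosc; exact: nosc.
move=> [mu [mmu ntmu]]; have [smu _] := mmu; exists mu; split.
  exact/continuous_seqP/maharam_seq_continuous.
(* Continuity at the full set with tolerance [mu setT] would give a finite set of positive
   submeasure. *)
move=> /(_ (fun=> true))/cvgrPdist_lt/(_ _ ntmu.1)/finite_dense[y [muy fy]].
move: muy; rewrite (nontrivial_finite smu ntmu fy) subr0.
rewrite (_ : [set _ | _] = setT); last by apply/seteqP.
by rewrite ger0_norm ?ltxx// ltW// ntmu.1.
Qed.
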